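(* Let $A(\cdot)=(A(n))_{n\in\mathbb{N}}$ be a Lyapunov sequence of matrices in $\mathbb{R}^{s\times s}$. If the system $x(n+1)=A(n)x(n)$, $n\in\mathbb{N}$, $x\in\mathbb{R}^s$, has a splitted fundamental system of solutions which is not normal, then the Lyapunov spectrum of this system is not stable.
   Context: $\mathbb{N}=\{1,2,\dots\}$. $\mathbb{R}^s$ carries the Euclidean norm and $\mathbb{R}^{s\times s}$ the corresponding operator (spectral) norm. For a sequence $F(\cdot)$ of matrices, $\|F\|_\infty=\sup_{n\in\mathbb{N}}\|F(n)\|$. A Lyapunov sequence is a bounded sequence of invertible matrices $L(n)\in\mathbb{R}^{s\times s}$, $n\in\mathbb{N}$, whose sequence of inverses $L^{-1}(n)$ is also bounded. A fundamental system of solutions (FSS) is a set of $s$ linearly independent solutions (defined on $\mathbb{N}$). The Lyapunov exponent of a nontrivial solution $x(\cdot)$ is $\lambda[x]=\limsup_{n\to\infty}\frac1n\ln\|x(n)\|$. The exponents of nontrivial solutions take finitely many values $\Lambda_1<\dots<\Lambda_r$, $r\le s$. Let $N_j$ be the dimension of the linear space of all solutions with exponent not exceeding $\Lambda_j$ (the trivial solution having exponent $-\infty$). An FSS is normal if for each $j=1,\dots,r$ the number of its solutions with exponent at most $\Lambda_j$ equals $N_j$. Normal FSS always exist, and the collection of Lyapunov exponents (with repetitions, in nondecreasing order) of the solutions of a normal FSS does not depend on the choice of the normal FSS; it is the Lyapunov spectrum $\lambda(A)=(\lambda_1(A),\dots,\lambda_s(A))$, $\lambda_1(A)\le\dots\le\lambda_s(A)$.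 Stability. $\mathbb{R}^s_{\le}$ is the set of nondecreasing sequences of $s$ real numbers; for $\mu\in\mathbb{R}^s_\le$ and $\varepsilon>0$, $\mathcal{O}_\varepsilon(\mu)=\{\nu\in\mathbb{R}^s_\le:\max_j|\nu_j-\mu_j|<\varepsilon\}$. A sequence $Q(\cdot)$ of matrices in $\mathbb{R}^{s\times s}$ is an admissible additive perturbation if $A(\cdot)+Q(\cdot)$ is a Lyapunov sequence; then $\lambda(A+Q)$ denotes the Lyapunov spectrum of $x(n+1)=(A(n)+Q(n))x(n)$. The Lyapunov spectrum of $x(n+1)=A(n)x(n)$ is stable if for any $\varepsilon>0$ there exists $\delta>0$ such that $\lambda(A+Q)\in\mathcal{O}_\varepsilon(\lambda(A))$ for every admissible additive perturbation $Q(\cdot)$ with $\|Q\|_\infty<\delta$. The angle between nonzero vectors is $\sphericalangle(p,q)=\arccos\frac{\langle p,q\rangle}{\|p\|\|q\|}$, and the angle between a nonzero vector $p$ and a linear subspace $V$ is $\sphericalangle(p;V)=\inf_{0\ne q\in V}\sphericalangle(p,q)$ (for $V=\{0\}$, which occurs below only when $s=1$, the infimum is read as $+\infty$). Broken away solutions and splitted FSS. Let $\{x_1(\cdot),\dots,x_s(\cdot)\}$ be an FSS. For $i\in\{1,\dots,s\}$ and $n\in\mathbb{N}$ let $V_i(n)$ be the linear span of the vectors $x_j(n)$, $j\ne i$, and let $\varphi_i(n)=\sphericalangle(x_i(n);V_i(n))$. For $\sigma\in\mathbb{N}$, $\gamma\in(0,\frac{\pi}{2}]$, $k\in\mathbb{N}$,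 let $N_i^\gamma(k;\sigma)$ be the number of $j\in\{1,\dots,k\}$ with $\varphi_i(j\sigma)\ge\gamma$, and let $g_i^\gamma(k;\sigma)=N_i^\gamma(k;\sigma)/k$. A realizing sequence of a solution $x(\cdot)$ is a strictly increasing sequence $(n_k)_{k\in\mathbb{N}}$ of natural numbers tending to $+\infty$ with $\lambda[x]=\lim_{k\to\infty}\frac{\ln\|x(n_k)\|}{n_k}$. The solution $x_i(\cdot)$ of the FSS is called $\sigma$-broken away if there exist $\gamma\in(0,\frac{\pi}{2}]$ and a realizing sequence of $x_i(\cdot)$ of the form $(k_n\sigma)_{n\in\mathbb{N}}$, $k_n\in\mathbb{N}$, such that the limit $\lim_{n\to\infty}g_i^\gamma(k_n;\sigma)$ exists and is positive. The FSS is $\sigma$-splitted if each of its solutions is $\sigma$-broken away, and it is called splitted if it is $\sigma$-splitted for some $\sigma\in\mathbb{N}$. *)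

(* Defs.v *)
From HB Require Import structures.
From mathcomp Require Import all_boot all_order all_algebra.
From mathcomp Require Import all_classical all_reals all_analysis.

Set Implicit Arguments.
Unset Strict Implicit.
Unset Printing Implicit Defensive.

Import Order.TTheory GRing.Theory Num.Theory.
Import numFieldNormedType.Exports.

Local Open Scope classical_set_scope.
Local Open Scope ring_scope.

(* The time set is {1, 2, ...}.  Sequences are functions on [nat] whose value
   at 0 is never constrained or used: every quantifier over time carries
   [(0 < n)%N]. *)

(* The norm that the library puts on matrices is the max norm, hence the
   explicit Euclidean and operator norms. *)
Definition dotv (R : realType) (s : nat) (p q : 'cV[R]_s) : R :=
  \sum_(i < s) p i 0 * q i 0.

Definition enorm (R : realType) (s : nat) (v : 'cV[R]_s) : R :=
  Num.sqrt (dotv v v).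

Definition opnorm (R : realType) (s : nat) (M : 'M[R]_s) : R :=
  sup [set enorm (M *m v) | v in [set v : 'cV[R]_s | enorm v <= 1]].

Definition seqnorm (R : realType) (s : nat) (F : nat -> 'M[R]_s) : \bar R :=
  ereal_sup [set (opnorm (F n))%:E | n in [set n : nat | (0 < n)%N]].

Definition lyapunov_sequence (R : realType) (s : nat) (L : nat -> 'M[R]_s) :
    Prop :=
  [/\ forall n : nat, (0 < n)%N -> L n \in unitmx,
      (seqnorm L < +oo)%E
    & (seqnorm (fun n => invmx (L n)) < +oo)%E].

Definition solution (R : realType) (s : nat) (A : nat -> 'M[R]_s)
    (x : nat -> 'cV[R]_s) : Prop :=
  forall n : nat, (0 < n)%N -> x n.+1 = A n *m x n.

Definition trivial_sol (R : realType) (s : nat) (x : nat -> 'cV[R]_s) : Prop :=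
  forall n : nat, (0 < n)%N -> x n = 0.

Definition lin_indep (R : realType) (s d : nat)
    (b : 'I_d -> nat -> 'cV[R]_s) : Prop :=
  forall c : 'I_d -> R,
    (forall n : nat, (0 < n)%N -> \sum_(i < d) c i *: b i n = 0) ->
    forall i : 'I_d, c i = 0.

Definition has_dim (R : realType) (s : nat) (V : set (nat -> 'cV[R]_s))
    (d : nat) : Prop :=
  exists b : 'I_d -> nat -> 'cV[R]_s,
    [/\ forall i : 'I_d, V (b i),
        lin_indep b
      & forall x, V x -> exists c : 'I_d -> R,
          forall n : nat, (0 < n)%N -> x n = \sum_(i < d) c i *: b i n].

Definition fss (R : realType) (s : nat) (A : nat -> 'M[R]_s)
    (x : 'I_s -> nat -> 'cV[R]_s) : Prop :=
  (forall i : 'I_s, solution A (x i)) /\ lin_indep x.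

Definition lyap_exp (R : realType) (s : nat) (x : nat -> 'cV[R]_s) : \bar R :=
  if `[< trivial_sol x >] then -oo%E
  else limn_esup (fun n : nat => (n%:R^-1 * ln (enorm (x n)))%:E).

Definition sol_le (R : realType) (s : nat) (A : nat -> 'M[R]_s)
    (Lam : \bar R) : set (nat -> 'cV[R]_s) :=
  [set z | solution A z /\ (lyap_exp z <= Lam)%E].

(* [Lam] ranges over the values taken by the exponents of nontrivial
   solutions. *)
Definition normal_fss (R : realType) (s : nat) (A : nat -> 'M[R]_s)
    (x : 'I_s -> nat -> 'cV[R]_s) : Prop :=
  fss A x /\
  forall Lam : \bar R,
    (exists z, [/\ solution A z, ~ trivial_sol z & lyap_exp z = Lam]) ->
    has_dim (sol_le A Lam) #|[pred i : 'I_s | (lyap_exp (x i) <= Lam)%E]|.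

Definition nondecr (R : realType) (s : nat) (mu : 'rV[R]_s) : Prop :=
  forall i j : 'I_s, (i <= j)%N -> mu 0 i <= mu 0 j.

(* Normality does not depend on the numbering of the solutions, so the normal
   system may be taken numbered by nondecreasing exponents. *)
Definition is_lyap_spectrum (R : realType) (s : nat) (A : nat -> 'M[R]_s) :
    set 'rV[R]_s :=
  [set mu | nondecr mu /\
     exists x : 'I_s -> nat -> 'cV[R]_s,
       normal_fss A x /\ forall j : 'I_s, lyap_exp (x j) = (mu 0 j)%:E].

(* The default value 0 is irrelevant: a Lyapunov sequence has exactly one
   spectrum. *)
Definition lyap_spectrum (R : realType) (s : nat) (A : nat -> 'M[R]_s) :
    'rV[R]_s :=
  xget 0 (is_lyap_spectrum A).

Definition spec_nbhd (R : realType) (s : nat) (e : R) (mu : 'rV[R]_s) :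
    set 'rV[R]_s :=
  [set nu | nondecr nu /\ \big[Num.max/0]_(j < s) `|nu 0 j - mu 0 j| < e].

Definition admissible (R : realType) (s : nat) (A Q : nat -> 'M[R]_s) : Prop :=
  lyapunov_sequence (fun n => A n + Q n).

Definition stable_spectrum (R : realType) (s : nat) (A : nat -> 'M[R]_s) :
    Prop :=
  forall e : R, 0 < e -> exists2 d : R, 0 < d &
    forall Q : nat -> 'M[R]_s, admissible A Q -> (seqnorm Q < d%:E)%E ->
      spec_nbhd e (lyap_spectrum A) (lyap_spectrum (fun n => A n + Q n)).

Definition angle (R : realType) (s : nat) (p q : 'cV[R]_s) : R :=
  acos (dotv p q / (enorm p * enorm q)).

(* Extended-real valued, so that the infimum is +oo for the zero subspace. *)
Definition angle_sub (R : realType) (s : nat) (p : 'cV[R]_s)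
    (V : {vspace 'cV[R]_s}) : \bar R :=
  ereal_inf [set (angle p q)%:E | q in [set q | q != 0 /\ q \in V]].

Definition span_others (R : realType) (s : nat) (x : 'I_s -> nat -> 'cV[R]_s)
    (i : 'I_s) (n : nat) : {vspace 'cV[R]_s} :=
  <<[seq x j n | j <- enum 'I_s & j != i]>>%VS.

Definition phi (R : realType) (s : nat) (x : 'I_s -> nat -> 'cV[R]_s)
    (i : 'I_s) (n : nat) : \bar R :=
  angle_sub (x i n) (span_others x i n).

Definition Ncount (R : realType) (s : nat) (x : 'I_s -> nat -> 'cV[R]_s)
    (i : 'I_s) (gamma : R) (k sigma : nat) : nat :=
  count (fun j : nat => (gamma%:E <= phi x i (j * sigma)%N)%E) (iota 1 k).

Definition gfreq (R : realType) (s : nat) (x : 'I_s -> nat -> 'cV[R]_s)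
    (i : 'I_s) (gamma : R) (k sigma : nat) : R :=
  (Ncount x i gamma k sigma)%:R / k%:R.

Definition realizing (R : realType) (s : nat) (x : nat -> 'cV[R]_s)
    (nk : nat -> nat) : Prop :=
  [/\ forall m : nat, (0 < nk m)%N,
      {homo nk : a b / (a < b)%N}
    & (fun m : nat => (ln (enorm (x (nk m))) / (nk m)%:R)%:E) @ \oo
        --> lyap_exp x].

Definition broken_away (R : realType) (s : nat) (x : 'I_s -> nat -> 'cV[R]_s)
    (sigma : nat) (i : 'I_s) : Prop :=
  exists (gamma : R) (k : nat -> nat),
    [/\ 0 < gamma <= pi / 2,
        realizing (x i) (fun m => (k m * sigma)%N)
      & exists2 l : R, 0 < l &
          (fun m : nat => gfreq x i gamma (k m) sigma) @ \oo --> l].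

Definition splitted (R : realType) (s : nat) (x : 'I_s -> nat -> 'cV[R]_s) :
    Prop :=
  exists2 sigma : nat, (0 < sigma)%N &
    forall i : 'I_s, broken_away x sigma i.

(* Main.v *)
(* Let [x] be the splitted system.  Along the times [j * sigma] at which [x i]
   makes an angle at least [gamma i] with the span of the other solutions,
   multiplying [x i] by [exp (d i)] and leaving the others alone is a
   perturbation of the coefficient matrix of size O([d i] / sin (gamma i)).
   This produces a nearby system solved by [exp (d i * M i n) *: x i n], where
   [M i] counts the boosts so far.  As [x i] is broken away, boosts have positive
   frequency along a realizing sequence, so its exponent, a convex function of
   [d i], strictly exceeds the old one and is strictly increasing for [d i > 0].
   Hence arbitrarily small [d i] make the new exponents pairwise distinct, and
   the new fundamental system is normal: the spectrum of the perturbed system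
   consists of numbers larger than the corresponding exponents of [x].  Since [x]
   is not normal, for some [a] the spectrum of the original system has more than
   [p] entries up to [a], where [p] is the number of exponents of [x] up to [a].
   The entry of index [p] therefore jumps from at most [a] to at least the least
   exponent of [x] above [a], whatever the size of the perturbation. *)

Require Import Defs.
From HB Require Import structures.
From mathcomp Require Import all_boot all_order all_algebra.
From mathcomp Require Import all_classical all_reals all_analysis.
From mathcomp Require Import ring lra zify.

Set Implicit Arguments.
Unset Strict Implicit.
Unset Printing Implicit Defensive.

Import Order.TTheory GRing.Theory Num.Theory.
Import numFieldNormedType.Exports.

Local Open Scope classical_set_scope.
Local Open Scope ring_scope.

(** * Euclidean norm and angles *)

Lemma dotvC (R : realType) s (p q : 'cV[R]_s) : dotv p q = dotv q p.
Proof. by apply: eq_bigr => i _; rewrite mulrC. Qed.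

Lemma dotvDl (R : realType) s (p q r : 'cV[R]_s) :
  dotv (p + q) r = dotv p r + dotv q r.
Proof. by rewrite -big_split; apply: eq_bigr => i _; rewrite mxE mulrDl. Qed.

Lemma dotvZl (R : realType) s c (p q : 'cV[R]_s) :
  dotv (c *: p) q = c * dotv p q.
Proof. by rewrite mulr_sumr; apply: eq_bigr => i _; rewrite mxE mulrA. Qed.

Lemma dotvDr (R : realType) s (p q r : 'cV[R]_s) :
  dotv p (q + r) = dotv p q + dotv p r.
Proof. by rewrite dotvC dotvDl !(dotvC p). Qed.

Lemma dotvZr (R : realType) s c (p q : 'cV[R]_s) :
  dotv p (c *: q) = c * dotv p q.
Proof. by rewrite dotvC dotvZl dotvC. Qed.

Lemma dotv_ge0 (R : realType) s (p : 'cV[R]_s) : 0 <= dotv p p.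
Proof. by apply: sumr_ge0 => i _; rewrite -expr2 sqr_ge0. Qed.

Lemma dotv_eq0 (R : realType) s (p : 'cV[R]_s) : (dotv p p == 0) = (p == 0).
Proof.
apply/eqP/eqP => [/eqP|->]; last first.
  by rewrite /dotv big1 // => i _; rewrite mxE mul0r.
rewrite psumr_eq0 => [/allP p0|i _]; last by rewrite -expr2 sqr_ge0.
apply/matrixP => i j; rewrite ord1 mxE; apply/eqP.
by have := p0 i (mem_index_enum _); rewrite mulf_eq0 orbb.
Qed.

Lemma enorm_ge0 (R : realType) s (p : 'cV[R]_s) : 0 <= enorm p.
Proof. exact: sqrtr_ge0. Qed.

Lemma sqr_enorm (R : realType) s (p : 'cV[R]_s) : enorm p ^+ 2 = dotv p p.
Proof. by rewrite sqr_sqrtr // dotv_ge0. Qed.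

Lemma enorm_eq0 (R : realType) s (p : 'cV[R]_s) : (enorm p == 0) = (p == 0).
Proof. by rewrite -sqrf_eq0 sqr_enorm dotv_eq0. Qed.

Lemma enorm0 (R : realType) s : enorm (0 : 'cV[R]_s) = 0.
Proof. by apply/eqP; rewrite enorm_eq0. Qed.

Lemma enorm_gt0 (R : realType) s (p : 'cV[R]_s) : (0 < enorm p) = (p != 0).
Proof. by rewrite lt0r enorm_eq0 enorm_ge0 andbT. Qed.

Lemma enormZ (R : realType) s c (p : 'cV[R]_s) :
  enorm (c *: p) = `|c| * enorm p.
Proof.
by rewrite /enorm dotvZl dotvZr mulrA -expr2 sqrtrM ?sqr_ge0 // sqrtr_sqr.
Qed.

Lemma dotv_cauchy_schwarz (R : realType) s (p q : 'cV[R]_s) :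
  `|dotv p q| <= enorm p * enorm q.
Proof.
have [->|q0] := eqVneq q 0.
  by rewrite /dotv big1 ?normr0 ?mulr_ge0 ?enorm_ge0 // => i _; rewrite mxE mulr0.
have qq : 0 < dotv q q by rewrite lt0r dotv_eq0 q0 dotv_ge0.
rewrite -(@ler_pXn2r _ 2) ?nnegrE ?mulr_ge0 ?enorm_ge0 // exprMn !sqr_enorm.
rewrite real_normK ?num_real //.
have := dotv_ge0 (dotv q q *: p + (- dotv p q) *: q).
rewrite !(dotvDl, dotvDr, dotvZl, dotvZr) (dotvC q p).
set a := dotv p p; set b := dotv p q; set c := dotv q q.
move=> h; have : 0 <= c * (a * c - b ^+ 2) by lra.
by rewrite pmulr_rge0 // subr_ge0.
Qed.

Lemma enormD (R : realType) s (p q : 'cV[R]_s) :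
  enorm (p + q) <= enorm p + enorm q.
Proof.
rewrite -(@ler_pXn2r _ 2) ?nnegrE ?addr_ge0 ?enorm_ge0 //.
rewrite sqr_enorm sqrrD !sqr_enorm dotvDl !dotvDr (dotvC q p).
have := le_trans (ler_norm _) (dotv_cauchy_schwarz p q).
by move=> ?; lra.
Qed.

Lemma enorm_sum (R : realType) s (I : Type) (r : seq I) (F : I -> 'cV[R]_s) :
  enorm (\sum_(i <- r) F i) <= \sum_(i <- r) enorm (F i).
Proof.
elim/big_ind2 : _ => // [|p a q b pa qb]; first by rewrite enorm0.
by rewrite (le_trans (enormD _ _)) // lerD.
Qed.

Lemma le_coord_enorm (R : realType) s (p : 'cV[R]_s) i : `|p i 0| <= enorm p.
Proof.
rewrite -(@ler_pXn2r _ 2) ?nnegrE ?enorm_ge0 // sqr_enorm.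
rewrite real_normK ?num_real // /dotv (bigD1 i) //= -expr2 lerDl.
by apply: sumr_ge0 => j _; rewrite -expr2 sqr_ge0.
Qed.

Lemma enorm_mulmx_bounded (R : realType) s (M : 'M[R]_s) :
  exists C, forall v, enorm (M *m v) <= C * enorm v.
Proof.
exists (\sum_j enorm (col j M)) => v.
have -> : M *m v = \sum_j v j 0 *: col j M.
  apply/matrixP => i k; rewrite ord1 mxE summxE; apply: eq_bigr => j _.
  by rewrite !mxE mulrC.
rewrite (le_trans (enorm_sum _ _)) // mulr_suml; apply: ler_sum => j _.
by rewrite enormZ mulrC ler_wpM2l ?enorm_ge0 // le_coord_enorm.
Qed.

Lemma opnorm_le (R : realType) s (M : 'M[R]_s) C : 0 <= C ->
  (forall v, enorm (M *m v) <= C * enorm v) -> opnorm M <= C.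
Proof.
move=> C0 MC; apply: ge_sup.
  by exists (enorm (M *m 0)), 0 => //=; rewrite enorm0.
move=> _ [v /= v1 <-]; rewrite (le_trans (MC v)) //.
by rewrite -[leRHS]mulr1 ler_wpM2l.
Qed.

Lemma enorm_mulmx (R : realType) s (M : 'M[R]_s) v :
  enorm (M *m v) <= opnorm M * enorm v.
Proof.
have [->|v0] := eqVneq v 0; first by rewrite mulmx0 enorm0 mulr0.
have vp : 0 < enorm v by rewrite enorm_gt0.
rewrite -ler_pdivrMr //.
have -> : enorm (M *m v) / enorm v = enorm (M *m ((enorm v)^-1 *: v)).
  by rewrite -scalemxAr enormZ ger0_norm ?invr_ge0 ?enorm_ge0 // mulrC.
apply: ub_le_sup; last first.
  exists ((enorm v)^-1 *: v) => //=.
  rewrite enormZ ger0_norm ?invr_ge0 ?enorm_ge0 //.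
  by rewrite mulVf // gt_eqF.
have [C MC] := enorm_mulmx_bounded M.
exists `|C| => _ [w /= w1 <-]; rewrite (le_trans (MC w)) //.
rewrite -[leRHS]mulr1 (le_trans (ler_norm _)) // normrM ler_wpM2l //.
by rewrite ger0_norm ?enorm_ge0.
Qed.

Lemma seqnorm_bounded (R : realType) s (L : nat -> 'M[R]_s) :
  (seqnorm L < +oo)%E -> exists2 C, 0 <= C &
  forall n v, (0 < n)%N -> enorm (L n *m v) <= C * enorm v.
Proof.
move=> Loo; exists `|fine (seqnorm L)| => // n v n0.
have Ln : ((opnorm (L n))%:E <= seqnorm L)%E by apply: ereal_sup_ubound; exists n.
rewrite (le_trans (enorm_mulmx _ _)) // ler_wpM2r ?enorm_ge0 //.
rewrite (le_trans _ (ler_norm _)) //.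
by move: Loo Ln; case: (seqnorm L).
Qed.

Lemma seqnorm_le (R : realType) s (L : nat -> 'M[R]_s) C : 0 <= C ->
  (forall n v, (0 < n)%N -> enorm (L n *m v) <= C * enorm v) ->
  (seqnorm L <= C%:E)%E.
Proof.
move=> C0 LC; apply: ge_ereal_sup => _ [n /= n0 <-].
by rewrite lee_fin opnorm_le // => v; exact: LC.
Qed.

(** Cosine decreases on [0, pi], and Cauchy-Schwarz keeps the argument of [acos] in [-1, 1]. *)
Lemma angle_dotv_le (R : realType) s (g : R) (p q : 'cV[R]_s) :
  0 < g <= pi / 2 -> p != 0 -> q != 0 -> g <= angle p q ->
  dotv p q <= cos g * (enorm p * enorm q).
Proof.
move=> /andP[g0 gpi] p0 q0; rewrite /angle => gpq.
have pq0 : 0 < enorm p * enorm q by rewrite mulr_gt0 ?enorm_gt0.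
rewrite -ler_pdivrMr //; set c := _ / _ in gpq *.
have pi0 := pi_gt0 R.
have c1 : -1 <= c <= 1.
  rewrite -ler_norml normrM normfV (ger0_norm (ltW pq0)) ler_pdivrMr // mul1r.
  exact: dotv_cauchy_schwarz.
rewrite leNgt; apply/negP => gc; move: gpq; apply/negP; rewrite -ltNge.
rewrite -ltr_cos ?acosK ?in_itv //=.
- by rewrite acos_ge0 // acos_lepi.
- by apply/andP; split; lra.
Qed.

(** The distance from [p] to [V] is at least [sin g] times |p|: with a = |p|, b = |v|, c = cos g,
    the bound <p, v> >= - c a b gives |p + v|^2 >= (1 - c^2) a^2 + (b - c a)^2. *)
Lemma component_le (R : realType) s (g : R) (p : 'cV[R]_s)
    (V : {vspace 'cV[R]_s}) v :
  0 < g <= pi / 2 -> (g%:E <= angle_sub p V)%E -> v \in V ->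
  sin g * enorm p <= enorm (p + v).
Proof.
move=> gpi gV vV.
have pi0 := pi_gt0 R.
have sg : 0 <= sin g.
  by apply: sin_ge0_pi; move: gpi => /andP[? ?]; apply/andP; split; lra.
have cg : 0 <= cos g.
  by apply: cos_ge0_pihalf; move: gpi => /andP[? ?]; apply/andP; split; lra.
have [->|p0] := eqVneq p 0; first by rewrite enorm0 mulr0 enorm_ge0.
have [->|v0] := eqVneq v 0.
  by rewrite addr0 ler_piMl ?enorm_ge0 // sin_le1.
(* The angle hypothesis is used at [- v], since the sum [p + v] is shortest when [v] points away
   from [p]. *)
have : dotv p (- v) <= cos g * (enorm p * enorm (- v)).
  apply: angle_dotv_le => //; first by rewrite oppr_eq0.
  rewrite -lee_fin (le_trans gV) //; apply: ereal_inf_lbound.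
  by exists (- v) => //=; rewrite oppr_eq0 memvN.
rewrite -scaleN1r dotvZr enormZ normrN1 mul1r mulN1r => pv.
rewrite -(@ler_pXn2r _ 2) ?nnegrE ?mulr_ge0 ?enorm_ge0 //.
rewrite exprMn sin2cos2 [leRHS]sqr_enorm !(dotvDl,dotvDr) (dotvC v p) -!sqr_enorm.
have := sqr_ge0 (enorm v - cos g * enorm p).
move: pv; set a := enorm p; set b := enorm v; set c := cos g; set d := dotv p v.
by move=> ? ?; nra.
Qed.

(** * Exponents of solutions *)

Lemma limn_esup_leP (R : realType) (u : nat -> R) (a : R) :
  (limn_esup (fun n => (u n)%:E) <= a%:E)%E <->
  forall e, 0 < e -> \forall n \near \oo, u n <= a + e.
Proof.
split=> [ua e e0|ua].
  have : (limn_esup (fun n => (u n)%:E) < (a + e)%:E)%E.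
    by rewrite (le_lt_trans ua) // lte_fin ltrDl.
  move=> /ereal_inf_lt[_ [V Voo <-] Vae].
  near=> n; rewrite -lee_fin (le_trans _ (ltW Vae)) //.
  by apply: ereal_sup_ubound; exists n => //; near: n.
apply/lee_addgt0Pr => e e0; have := ua e e0 => ue.
apply: (@le_trans _ _ (ereal_sup ((fun n => (u n)%:E) @` [set n | u n <= a + e]))).
  by apply: ereal_inf_lbound; exists [set n | u n <= a + e].
by apply: ge_ereal_sup => _ [n /= un <-]; rewrite lee_fin.
Unshelve. all: by end_near. Qed.

Section exponent.
Variables (R : realType) (s : nat).
Implicit Types (x y : nat -> 'cV[R]_s) (a : R).

Lemma eq_lyap_exp x y : (forall n, (0 < n)%N -> x n = y n) ->
  lyap_exp x = lyap_exp y.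
Proof.
move=> xy; rewrite /lyap_exp.
have -> : trivial_sol x = trivial_sol y.
  by apply/propext; split=> h n n0; [rewrite -xy|rewrite xy] => //; exact: h.
congr (if _ then _ else limn_esup _); apply/funext => -[|n].
  by rewrite invr0 !mul0r.
by rewrite xy.
Qed.

Lemma lyap_exp_trivial x : trivial_sol x -> lyap_exp x = -oo%E.
Proof. by move=> x0; rewrite /lyap_exp asboolT. Qed.

Lemma lyap_exp_le_lnP x a : (forall n, (0 < n)%N -> x n != 0) ->
  (lyap_exp x <= a%:E)%E <->
  forall e, 0 < e -> \forall n \near \oo, ln (enorm (x n)) <= (a + e) * n%:R.
Proof.
move=> x0; rewrite /lyap_exp asboolF; last first.
  by move=> /(_ 1%N isT) /eqP; rewrite (negPf (x0 _ _)).
rewrite limn_esup_leP; split=> xa e /xa h; near=> n.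
  have n0 : (0 < n)%N by near: n; exact: nbhs_infty_gt.
  rewrite -ler_pdivrMr ?ltr0n // mulrC; near: n; exact: h.
have n0 : (0 < n)%N by near: n; exact: nbhs_infty_gt.
rewrite mulrC ler_pdivrMr ?ltr0n //; near: n; exact: h.
Unshelve. all: by end_near. Qed.

(** The exponential form avoids the logarithm of zero, so it also covers the trivial solution. *)
Lemma lyap_exp_leP x a : trivial_sol x \/ (forall n, (0 < n)%N -> x n != 0) ->
  (lyap_exp x <= a%:E)%E <->
  forall e, 0 < e -> \forall n \near \oo, enorm (x n) <= expR ((a + e) * n%:R).
Proof.
case=> [x0|x0].
  rewrite lyap_exp_trivial // leNye; split => // _ e e0; near=> n.
  have n0 : (0 < n)%N by near: n; exact: nbhs_infty_gt.
  by rewrite x0 // enorm0 expR_ge0.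
rewrite lyap_exp_le_lnP //; split=> xa e /xa h; near=> n.
  have n0 : (0 < n)%N by near: n; exact: nbhs_infty_gt.
  by rewrite -[leLHS]lnK ?posrE ?enorm_gt0 ?x0 // ler_expR; near: n; exact: h.
have n0 : (0 < n)%N by near: n; exact: nbhs_infty_gt.
by rewrite -ler_expR lnK ?posrE ?enorm_gt0 ?x0 //; near: n; exact: h.
Unshelve. all: by end_near. Qed.

End exponent.

(** * Solutions as functions of their initial values *)

Section flow.
Variables (R : realType) (s : nat) (A : nat -> 'M[R]_s).
Implicit Types (x y : nat -> 'cV[R]_s) (u v : 'cV[R]_s).

(** Time starts at 1, so [transition n] leads from time 1 to time n+1; hence the [n.-1] in [flow],
    which identifies a solution with its value at time 1. *)
Fixpoint transition n : 'M[R]_s :=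
  if n is m.+1 then A m.+1 *m transition m else 1%:M.

Definition flow v n := transition n.-1 *m v.

Lemma flow1 v : flow v 1%N = v.
Proof. exact: mul1mx. Qed.

Lemma flow_solution v : solution A (flow v).
Proof. by move=> [|n] // _; rewrite /flow /= mulmxA. Qed.

Lemma solution_flow x n : solution A x -> (0 < n)%N -> x n = flow (x 1%N) n.
Proof.
move=> Ax; elim: n => // -[|n] IH _; first by rewrite flow1.
by rewrite Ax // IH // (flow_solution (x 1%N) (n := n.+1)).
Qed.

Lemma flow_lin c u v n : flow (c *: u + v) n = c *: flow u n + flow v n.
Proof. by rewrite /flow mulmxDr scalemxAr. Qed.

Lemma flow_sum (I : Type) (r : seq I) (c : I -> R) (f : I -> 'cV[R]_s) n :
  flow (\sum_(i <- r) c i *: f i) n = \sum_(i <- r) c i *: flow (f i) n.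
Proof. by rewrite /flow mulmx_sumr; apply: eq_bigr => i _; rewrite scalemxAr. Qed.

Lemma lyap_exp_flow x : solution A x -> lyap_exp (flow (x 1%N)) = lyap_exp x.
Proof. by move=> Ax; apply: eq_lyap_exp => n n0; rewrite -solution_flow. Qed.

Hypothesis A_lyap : lyapunov_sequence A.

Lemma solution_neq0 x n : solution A x -> x 1%N != 0 -> (0 < n)%N -> x n != 0.
Proof.
have [Au _ _] := A_lyap.
move=> Ax x1; elim: n => // -[|n] IH _ //.
rewrite Ax //; apply/eqP => An0; move/eqP: (IH isT); apply.
by rewrite -[x _](mulKmx (Au n.+1 isT)) An0 mulmx0.
Qed.

Lemma trivial_sol_flow v : trivial_sol (flow v) <-> v = 0.
Proof.
split=> [/(_ 1%N isT)|-> n _]; first by rewrite flow1.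
by rewrite /flow mulmx0.
Qed.

Lemma flow_neq0 v n : v != 0 -> (0 < n)%N -> flow v n != 0.
Proof. by move=> v0; apply: solution_neq0; rewrite ?flow1 //; exact: flow_solution. Qed.

Lemma flow_dichotomy v :
  trivial_sol (flow v) \/ forall n, (0 < n)%N -> flow v n != 0.
Proof.
have [->|v0] := eqVneq v 0; first by left; apply/trivial_sol_flow.
by right=> n; exact: flow_neq0.
Qed.

Lemma lyap_exp_flow0 : lyap_exp (flow 0) = -oo%E.
Proof. by apply: lyap_exp_trivial; apply/trivial_sol_flow. Qed.

(** Constant factors do not change exponential rates, so the sublevel sets of the exponent are
    linear subspaces. *)
Lemma lyap_exp_flow_lin a c u v :
  (lyap_exp (flow u) <= a%:E)%E -> (lyap_exp (flow v) <= a%:E)%E ->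
  (lyap_exp (flow (c *: u + v)) <= a%:E)%E.
Proof.
move=> /(lyap_exp_leP _ (flow_dichotomy _)) ua.
move=> /(lyap_exp_leP _ (flow_dichotomy _)) va.
apply/(lyap_exp_leP _ (flow_dichotomy _)) => e e0.
have e2 : 0 < e / 2 by rewrite divr_gt0.
have {}ua := ua _ e2; have {}va := va _ e2.
near=> n.
(* Then |c| + 1 <= (e / 2) n <= exp ((e / 2) n), which absorbs the constant factor. *)
have hc : 2 / e * (`|c| + 1) <= n%:R by near: n; exact: nbhs_infty_ger.
have hu : enorm (flow u n) <= expR ((a + e / 2) * n%:R) by near: n; exact: ua.
have hv : enorm (flow v n) <= expR ((a + e / 2) * n%:R) by near: n; exact: va.
rewrite flow_lin (le_trans (enormD _ _)) // enormZ.
apply: (@le_trans _ _ ((`|c| + 1) * expR ((a + e / 2) * n%:R))).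
  by rewrite mulrDl mul1r lerD // ler_wpM2l.
have -> : (a + e) * n%:R = e / 2 * n%:R + (a + e / 2) * n%:R by field.
rewrite expRD ler_wpM2r ?expR_ge0 //.
have {}hc : `|c| + 1 <= e / 2 * n%:R.
  by rewrite mulrC -ler_pdivrMr // invf_div mulrC.
by rewrite (le_trans hc) // (le_trans _ (expR_ge1Dx _)) // lerDr.
Unshelve. all: by end_near. Qed.

(** As [A] and its inverses are bounded, one step changes the logarithm of the norm by a bounded
    amount. *)
Lemma solution_growth : exists2 c, 0 <= c & forall x n, solution A x ->
  x 1%N != 0 -> (0 < n)%N -> `|ln (enorm (x n)) - ln (enorm (x 1%N))| <= c * n%:R.
Proof.
have [Au /seqnorm_bounded[C1 C10 hC1] /seqnorm_bounded[C2 C20 hC2]] := A_lyap.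
(* Adding 1 to the bounds keeps their logarithms nonnegative. *)
have D10 : 0 < C1 + 1 by rewrite ltr_wpDl.
have D20 : 0 < C2 + 1 by rewrite ltr_wpDl.
have l1 : 0 <= ln (C1 + 1) by rewrite ln_ge0 // lerDr.
have l2 : 0 <= ln (C2 + 1) by rewrite ln_ge0 // lerDr.
exists (ln (C1 + 1) + ln (C2 + 1)); first by rewrite addr_ge0.
move=> x n Ax x1; elim: n => // -[|n] IH _.
  by rewrite subrr normr0 !mulr_ge0 ?addr_ge0.
have xp m : (0 < m)%N -> 0 < enorm (x m).
  by move=> m0; rewrite enorm_gt0; exact: solution_neq0.
have := xp n.+1 isT; have := xp n.+2 isT; move: (IH isT).
have : enorm (x n.+2) <= (C1 + 1) * enorm (x n.+1).
  by rewrite Ax // (le_trans (hC1 _ _ _)) // ler_wpM2r ?enorm_ge0 // lerDl.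
have : enorm (x n.+1) <= (C2 + 1) * enorm (x n.+2).
  rewrite -[x n.+1](mulKmx (Au n.+1 isT)) -Ax //.
  by rewrite (le_trans (hC2 _ _ _)) // ler_wpM2r ?enorm_ge0 // lerDl.
set p := enorm (x n.+1); set q := enorm (x n.+2) => pq qp {}IH q0 p0.
have : ln p <= ln (C2 + 1) + ln q.
  by rewrite -lnM ?posrE // ler_ln ?posrE // mulr_gt0.
have : ln q <= ln (C1 + 1) + ln p.
  by rewrite -lnM ?posrE // ler_ln ?posrE // mulr_gt0.
move: IH; rewrite !ler_norml -[n.+2%:R]natr1 mulrDr mulr1 => /andP[? ?] ? ?.
by apply/andP; split; lra.
Qed.

Lemma lyap_exp_flow_fin v : v != 0 ->
  exists a, lyap_exp (flow v) = a%:E.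
Proof.
move=> v0; have [c c0 hc] := solution_growth.
have {}hc n : (0 < n)%N ->
    `|ln (enorm (flow v n)) - ln (enorm v)| <= c * n%:R.
  move=> n0; rewrite -{2}(flow1 v) hc //; first exact: flow_solution.
  by rewrite flow1.
have up : (lyap_exp (flow v) <= (c + 1)%:E)%E.
  apply/lyap_exp_le_lnP => [n|e e0]; first exact: flow_neq0.
  near=> n; have := hc n; rewrite ler_norml => /(_ _)/andP[|_ h].
    by near: n; exact: nbhs_infty_gt.
  have : ln (enorm v) <= n%:R by near: n; exact: nbhs_infty_ger.
  have : 0 <= e * n%:R by rewrite mulr_ge0 // ltW.
  by move=> ? ?; lra.
(* Otherwise the upper bound (- c - 1) n would fall below the lower bound ln |v| - c n once n > - ln
   |v|. *)
have dn : ~ (lyap_exp (flow v) <= (- c - 2)%:E)%E.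
  move/lyap_exp_le_lnP => /(_ (fun n => @flow_neq0 v n v0) 1 ltr01) h.
  suff : \forall n \near \oo, False by move=> /filter_ex[].
  near=> n; have := hc n; rewrite ler_norml => /(_ _)/andP[|h1 _].
    by near: n; exact: nbhs_infty_gt.
  have : ln (enorm (flow v n)) <= (- c - 2 + 1) * n%:R by near: n; exact: h.
  have : 1 - ln (enorm v) <= n%:R by near: n; exact: nbhs_infty_ger.
  by move=> ? ?; lra.
move: up dn; case: (lyap_exp _) => // [r _ _|_ []]; first by exists r.
by rewrite leNye.
Unshelve. all: by end_near. Qed.

End flow.

(** * Sublevel spaces and normal systems *)

(** Take a subspace of largest dimension contained in [P]; a vector of [P] outside it would enlarge
    it. *)
Lemma vspace_of_closed (K : fieldType) (vT : vectType K) (P : vT -> Prop) :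
  P 0 -> (forall c u v, P u -> P v -> P (c *: u + v)) ->
  exists U : {vspace vT}, forall v, v \in U <-> P v.
Proof.
move=> P0 Plin.
pose Q d := `[< exists U : {vspace vT}, \dim U = d /\ forall v, v \in U -> P v >].
have exQ : exists d, Q d.
  exists 0; apply/asboolP; exists 0%VS; rewrite dimv0; split=> // v.
  by rewrite memv0 => /eqP ->.
have maxQ d : Q d -> (d <= \dim {:vT})%N.
  by move=> /asboolP[U [<- _]]; rewrite dimvS // subvf.
case: (ex_maxnP exQ maxQ) => d /asboolP[U [dU UP]] dmax.
exists U => v; split; first exact: UP.
move=> Pv; apply/contraT => vU.
have /dmax : Q (\dim (U + <[v]>)%VS).
  apply/asboolP; exists (U + <[v]>)%VS; split=> // w.
  move=> /memv_addP[u uU [_ /vlineP[c ->] ->]].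
  by rewrite addrC; apply: Plin => //; exact: UP.
rewrite -dU leqNgt => /negP[]; rewrite (ltn_leqif (dimv_leqif_eq (addvSl _ _))).
apply: contra vU => /eqP ->; by rewrite memvE addvSr.
Qed.

Lemma dim_span_subfamily (K : fieldType) (vT : vectType K) d (f : 'I_d -> vT)
    (P : pred 'I_d) : free [tuple f i | i < d] ->
  \dim <<[seq f i | i <- enum P]>> = #|P|.
Proof.
move=> ff; have : free [seq f i | i <- enum P].
  apply: (@catl_free _ _ [seq f i | i <- enum (predC P)]).
  rewrite -map_cat -(@perm_free _ _ [tuple f i | i < d]) //.
  rewrite /=; apply/perm_map/uniq_perm; rewrite ?cat_uniq ?enum_uniq //= ?andbT.
    by apply/hasPn => i; rewrite !mem_enum.
  by move=> i; rewrite mem_cat !mem_enum inE orbN.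
by move=> /eqP ->; rewrite size_map -cardE.
Qed.

Section level.
Variables (R : realType) (s : nat) (A : nat -> 'M[R]_s).

(** The subspace is picked by its membership property; for a Lyapunov sequence [vspace_of_closed]
    provides one, so the default is not taken. *)
Definition level (a : R) : {vspace 'cV[R]_s} :=
  xget 0%VS [set U : {vspace 'cV[R]_s} |
    forall v, v \in U <-> (lyap_exp (flow A v) <= a%:E)%E].

Hypothesis A_lyap : lyapunov_sequence A.

Lemma levelP a v : v \in level a <-> (lyap_exp (flow A v) <= a%:E)%E.
Proof.
move: v; rewrite /level; case: xgetP => [U _ //|noU].
have [|c u v|U /noU //] := @vspace_of_closed _ _
  (fun v : 'cV[R]_s => (lyap_exp (flow A v) <= a%:E)%E).
- by rewrite lyap_exp_flow0 leNye.
- exact: lyap_exp_flow_lin.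
Qed.

(** A solution is determined by its value at time 1, on which it depends linearly. *)
Lemma lin_indep_free d (b : 'I_d -> nat -> 'cV[R]_s) :
  (forall i, solution A (b i)) ->
  lin_indep b <-> free [tuple b i 1%N | i < d].
Proof.
move=> Ab; split=> [bind|/freeP bfree].
  apply/freeP => c c0; apply: bind => n n0.
  under eq_bigr do rewrite (solution_flow (Ab _) n0).
  rewrite -flow_sum -[RHS](mulmx0 _ (transition A n.-1)); congr (_ *m _).
  by rewrite -{}[RHS]c0; apply: eq_bigr => i _; rewrite -tnth_nth tnth_mktuple.
move=> c c0; apply: bfree; rewrite -[RHS](c0 1%N) //.
by apply: eq_bigr => i _; rewrite -tnth_nth tnth_mktuple.
Qed.

Lemma has_dim_level a d : has_dim (sol_le A a%:E) d <-> \dim (level a) = d.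
Proof.
split=> [[b [Vb /lin_indep_free bind bspan]]|<-].
  have /bind bfree : forall i, solution A (b i) by move=> i; have [] := Vb i.
  apply: (@size_basis _ _ _ d [tuple b i 1%N | i < d]).
  rewrite basisEfree bfree size_tuple /=; apply/andP; split.
    apply/span_subvP => _ /mapP[i _ ->]; apply/levelP.
    by have [Abi] := Vb i; rewrite lyap_exp_flow.
  suff lb : (level a <= <<[tuple b i 1%N | i < d]>>)%VS.
    by rewrite (leq_trans (dimvS lb)) // (leq_trans (dim_span _)) // size_tuple.
  apply/subvP => v /levelP va.
  have [|c hc] := bspan (flow A v); first by split=> //; exact: flow_solution.
  have := hc 1%N isT; rewrite flow1 => ->.
  apply: memv_suml => i _; rewrite memvZ // memv_span //; apply/mapP; exists i => //.
  by rewrite mem_enum.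
set U := level a; pose b (i : 'I_(\dim U)) := flow A (vbasis U)`_i.
exists b; split.
- move=> i; split; first exact: flow_solution.
  by apply/levelP; rewrite vbasis_mem // mem_nth // size_tuple.
- apply/lin_indep_free => [i|]; first exact: flow_solution.
  have -> : [tuple b i 1%N | i < \dim U] = vbasis U.
    by apply: eq_from_tnth => i; rewrite tnth_mktuple /b flow1 (tnth_nth 0).
  exact: basis_free (vbasisP _).
- move=> x [Ax xa]; have /coord_vbasis xc : x 1%N \in U.
    by apply/levelP; rewrite lyap_exp_flow.
  exists (fun i => coord (vbasis U) i (x 1%N)) => n n0.
  by rewrite (solution_flow Ax n0) {1}xc flow_sum.
Qed.

Lemma nontrivial_solutionP (L : \bar R) :
  (exists z, [/\ solution A z, ~ trivial_sol z & lyap_exp z = L]) <->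
  exists2 v, v != 0 & lyap_exp (flow A v) = L.
Proof.
split=> [[z [Az z0 zL]]|[v v0 vL]]; last first.
  exists (flow A v); split=> //; first exact: flow_solution.
  by move=> /trivial_sol_flow /eqP; exact/negP.
exists (z 1%N); last by rewrite lyap_exp_flow.
apply/eqP => z10; apply: z0 => n n0.
by rewrite (solution_flow Az n0) z10 /flow mulmx0.
Qed.

(** Exponents of nontrivial solutions are finite, so real values [a] suffice and normality becomes a
    count of dimensions in the space of initial values. *)
Lemma normal_fssP (x : 'I_s -> nat -> 'cV[R]_s) : fss A x ->
  normal_fss A x <-> forall a, (exists2 v, v != 0 & lyap_exp (flow A v) = a%:E) ->
    \dim (level a) = #|[pred i : 'I_s | (lyap_exp (x i) <= a%:E)%E]|.
Proof.
move=> fx; split=> [[_ nx] a /nontrivial_solutionP /nx /has_dim_level //|nx].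
split=> // L /nontrivial_solutionP[v v0 <-].
have [a va] := lyap_exp_flow_fin A_lyap v0.
by rewrite va; apply/has_dim_level/nx; exists v.
Qed.

Lemma fss_neq0 x i : fss A x -> x i 1%N != 0.
Proof.
move=> [Ax /(lin_indep_free Ax) xfree].
by apply: (free_not0 xfree); apply/mapP; exists i; rewrite ?mem_enum.
Qed.

Lemma fss_exp x i : fss A x -> exists a, lyap_exp (x i) = a%:E.
Proof.
move=> fx; have [a ha] := lyap_exp_flow_fin A_lyap (fss_neq0 i fx).
by exists a; rewrite -ha lyap_exp_flow //; case: fx.
Qed.

Lemma fss_span x : fss A x -> <<[tuple x i 1%N | i < s]>>%VS = fullv.
Proof.
move=> [Ax /(lin_indep_free Ax) xfree].
apply/eqP; rewrite eqEdim subvf /= (eqP xfree) size_tuple dimvf.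
by rewrite dim_matrix mulr1.
Qed.

Lemma span_fss_level x a : fss A x ->
  (<<[seq x i 1%N | i <- enum [pred i : 'I_s | (lyap_exp (x i) <= a%:E)%E]]>>
    <= level a)%VS.
Proof.
move=> [Ax _]; apply/span_subvP => _ /mapP[i + ->].
by rewrite mem_enum inE => ?; apply/levelP; rewrite lyap_exp_flow.
Qed.

(** The initial values of the counted solutions form a free family inside [level A a]. *)
Lemma card_fss_level x a : fss A x ->
  (#|[pred i : 'I_s | (lyap_exp (x i) <= a%:E)%E]| <= \dim (level a))%N.
Proof.
move=> fx; have [Ax /(lin_indep_free Ax) xfree] := fx.
by rewrite -(dim_span_subfamily _ xfree) dimvS // span_fss_level.
Qed.

Lemma fss_level_normal x : fss A x ->
  (forall a, (level a <=
     <<[seq x i 1%N |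
        i <- enum [pred i : 'I_s | (lyap_exp (x i) <= a%:E)%E]]>>)%VS) ->
  normal_fss A x.
Proof.
move=> fx lx; apply/normal_fssP => // a _.
have [Ax /(lin_indep_free Ax) xfree] := fx.
rewrite -(dim_span_subfamily _ xfree); congr (\dim _); apply/eqP.
by rewrite eqEsubv lx span_fss_level.
Qed.

(** When exponents are distinct, a combination has the largest exponent among its terms with nonzero
    coefficient, so each level is spanned by members of the system. *)
Lemma distinct_exp_normal x : fss A x ->
  injective (fun i => lyap_exp (x i)) -> normal_fss A x.
Proof.
move=> fx inj; have [Ax /(lin_indep_free Ax) xfree] := fx.
apply: fss_level_normal => // a; apply/subvP => v va.
have vx : v \in <<[tuple x i 1%N | i < s]>>%VS by rewrite (fss_span fx) memvf.
have [c vc] : exists c : 'I_s -> R, v = \sum_(i < s) c i *: x i 1%N.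
  exists (fun i => coord [tuple x i 1%N | i < s] i v); rewrite {1}(coord_span vx).
  by apply: eq_bigr => i _; rewrite -tnth_nth tnth_mktuple.
have {}inj i j : fine (lyap_exp (x i)) = fine (lyap_exp (x j)) -> i = j.
  have [a1 h1] := fss_exp i fx; have [a2 h2] := fss_exp j fx.
  by rewrite h1 h2 /= => h; apply: inj; rewrite h1 h2 h.
suff ca i : c i != 0 -> (lyap_exp (x i) <= a%:E)%E.
  rewrite vc; apply: memv_suml => i _.
  have [->|ci] := eqVneq (c i) 0; first by rewrite scale0r mem0v.
  rewrite memvZ // memv_span //; apply/mapP; exists i => //.
  by rewrite mem_enum inE ca.
move=> ci0; rewrite leNgt; apply/negP => ai0.
pose E i := fine (lyap_exp (x i)).
have xE i0 : lyap_exp (x i0) = (E i0)%:E.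
  by have [b hb] := fss_exp i0 fx; rewrite /E hb.
pose k := [arg max_(j > i | c j != 0) E j]%O.
have [ck kmax] : c k != 0 /\ forall j, c j != 0 -> E j <= E k.
  by rewrite /k; case: arg_maxP.
have ak : a < E k.
  by rewrite (lt_le_trans _ (kmax i ci0)) // -lte_fin -xE.
(* Both [v] and the terms other than that of [k] have exponent at most [b], which lies below [E k];
   solving for [x k] then contradicts its exponent. *)
pose b := \big[Num.max/a]_(j | (c j != 0) && (j != k)) E j.
have bk : b < E k.
  apply/bigmax_ltP; split=> // j /andP[cj jk].
  by rewrite lt_neqAle kmax // andbT; apply: contra jk => /eqP/inj ->.
have : x k 1%N \in level b.
  have -> : x k 1%N = (c k)^-1 *: (v - \sum_(j | j != k) c j *: x j 1%N).
    by rewrite vc (bigD1 k) //= addrK scalerA mulVf // scale1r.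
  rewrite memvZ // memvB //.
    apply/levelP; move/levelP: va => /le_trans; apply.
    by rewrite lee_fin; exact: bigmax_ge_id.
  apply: memv_suml => j jk.
  have [->|cj] := eqVneq (c j) 0; first by rewrite scale0r mem0v.
  rewrite memvZ //; apply/levelP; rewrite lyap_exp_flow // xE lee_fin.
  by apply: le_bigmax_cond; rewrite cj.
by move/levelP; rewrite lyap_exp_flow // xE lee_fin leNgt bk.
Qed.

End level.

(** * Greedy bases adapted to a filtration *)

Section filtration.
Variables (R : realType) (K : fieldType) (vT : vectType K).
Variables (E : vT -> \bar R) (lev : R -> {vspace vT}).
Hypothesis E_fin : forall v, v != 0 -> exists a, E v = a%:E.
Hypothesis levP : forall a v, v \in lev a <-> (E v <= a%:E)%E.

(* Take a vector whose level has the least dimension. *)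
Lemma min_outside (U : {vspace vT}) : (\dim U < dim vT)%N ->
  exists2 v, v \notin U & forall w, w \notin U -> (E v <= E w)%E.
Proof.
move=> Us.
have finite u : u \notin U -> exists a, E u = a%:E.
  by move=> uU; apply: E_fin; apply: contraNneq uU => ->; rewrite mem0v.
pose Q d := `[< exists v a, [/\ v \notin U, E v = a%:E & \dim (lev a) = d] >].
have [v0 v0U] : exists v, v \notin U.
  apply: contrapT => noU; move: Us; rewrite ltnNge => /negP; apply.
  have /dimvS : (fullv <= U)%VS.
    by apply/subvP => v _; apply: contraT => vU; case: noU; exists v.
  by rewrite dimvf.
have exQ : exists d, Q d.
  have [a va] := finite _ v0U.
  by exists (\dim (lev a)); apply/asboolP; exists v0, a.
case: (ex_minnP exQ) => d /asboolP[v [a [vU va vd]]] dmin.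
exists v => // w wU; have [c wc] := finite _ wU.
rewrite va wc lee_fin leNgt; apply/negP => ca.
have : (d <= \dim (lev c))%N by apply: dmin; apply/asboolP; exists w, c.
have sub : (lev c <= lev a)%VS.
  apply/subvP => u /levP uc; apply/levP.
  by apply: le_trans uc _; rewrite lee_fin ltW.
rewrite -vd leqNgt => /negP[]; rewrite (ltn_leqif (dimv_leqif_eq sub)).
apply/eqP => levE; have : v \in lev c by rewrite levE; apply/levP; rewrite va.
by move/levP; rewrite va lee_fin leNgt ca.
Qed.

(** Each step appends a vector of least [E] outside the span so far. The values increase because a
    later vector lies outside every earlier span. *)
Lemma greedy_free k : (k <= dim vT)%N -> exists b : seq vT,
  [/\ size b = k, free b,
      forall i v, (i < k)%N -> v \notin <<take i b>>%VS -> (E b`_i <= E v)%E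
    & forall i j, (i <= j < k)%N -> (E b`_i <= E b`_j)%E].
Proof.
elim: k => [_|k IH ks].
  by exists [::]; split; rewrite ?nil_free // => i j /andP[].
have [b [sb fb bmin bmono]] := IH (ltnW ks).
have [|v vb vmin] := @min_outside <<b>>; first by rewrite (eqP fb) sb.
have takeb i : (i <= k)%N -> take i (rcons b v) = take i b.
  by move=> ik; rewrite -cats1 takel_cat ?sb.
exists (rcons b v); split.
- by rewrite size_rcons sb.
- by rewrite (perm_free (Y := v :: b)) ?perm_rcons // free_cons vb.
- move=> i w; rewrite ltnS => ik; rewrite takeb // nth_rcons sb.
  move: ik; rewrite leq_eqVlt => /orP[/eqP->|ik wb].
    by rewrite ltnn eqxx -sb take_size; exact: vmin.
  by rewrite ik; exact: bmin.
- move=> i j /andP[ij]; rewrite ltnS leq_eqVlt => /orP[/eqP jk|jk].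
    subst j; rewrite !nth_rcons sb ltnn eqxx.
    case: ltngtP ij => // ik _; apply: bmin => //; apply: contra vb.
    by apply/subvP/span_subvP => w /mem_take; exact: memv_span.
  by rewrite !nth_rcons sb jk (leq_ltn_trans ij jk) bmono // ij.
Qed.

Lemma adapted_basis : exists (b : (dim vT).-tuple vT) (mu : 'I_(dim vT) -> R),
  [/\ free b, forall i, E (tnth b i) = (mu i)%:E,
      forall i j : 'I_(dim vT), (i <= j)%N -> mu i <= mu j
    & forall a,
        (lev a <= <<[seq tnth b i | i <- enum [pred i | (mu i <= a)%R]]>>)%VS].
Proof.
have [b [/eqP sb fb bmin bmono]] := greedy_free (leqnn _).
pose t := Tuple sb; have tE i : tnth t i = b`_i by rewrite (tnth_nth 0).
have /choice[mu muE] : forall i, exists a, E (tnth t i) = a%:E.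
  by move=> i; apply/E_fin/(free_not0 fb); rewrite tE mem_nth // (eqP sb).
exists t, mu; split=> // [i j ij|a].
  by rewrite -lee_fin -!muE !tE bmono // ij ltn_ord.
(* [k] is the first index where [E] exceeds [a], or the length of [b] if there is none. Were [v]
   outside the span of the first [k] vectors, minimality would give E b_k <= E v <= a. *)
apply/subvP => v /levP va; pose k := find (fun w => ~~ (E w <= a%:E)%E) b.
suff : v \in <<take k b>>%VS.
  apply/subvP/span_subvP => w /(nthP 0)[i].
  rewrite size_take -/(minn k (size b)) leq_min (eqP sb) => /andP[ik si].
  rewrite nth_take // => <-; apply: memv_span; apply/mapP.
  exists (Ordinal si); last by rewrite tE.
  rewrite mem_enum inE -lee_fin -muE tE /=.
  by apply: contraFT (before_find 0 ik).
have [sk|ks] := leqP (dim vT) k.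
  rewrite take_oversize ?(eqP sb) //; suff -> : <<b>>%VS = fullv by rewrite memvf.
  by apply/eqP; rewrite eqEdim subvf /= (eqP fb) (eqP sb) dimvf.
have hk : has (fun w => ~~ (E w <= a%:E)%E) b by rewrite has_find (eqP sb).
apply: contraT => vk; have := nth_find 0 hk; rewrite -/k => /negP[].
exact: le_trans (bmin _ _ ks vk) va.
Qed.

End filtration.

(** * Existence of the spectrum and counting with it *)

Section spectrum.
Variables (R : realType) (s : nat) (A : nat -> 'M[R]_s).
Hypothesis A_lyap : lyapunov_sequence A.

(** A basis of initial values adapted to the levels yields a normal system, so the default of [xget]
    does not arise. *)
Lemma lyap_spectrumP : is_lyap_spectrum A (lyap_spectrum A).
Proof.
apply: xgetPex.
have dims : dim 'cV[R]_s = s by rewrite dim_matrix mulr1.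
have := adapted_basis (lyap_exp_flow_fin A_lyap) (levelP A_lyap).
(* The dimension equals [s] only through a proof; abstracting it makes the index types agree. *)
move: (dim _) dims => d ds; subst d => -[b [mu [fb bmu mono levb]]].
pose x (i : 'I_s) := flow A (tnth b i).
have Ax i : solution A (x i) by exact: flow_solution.
have xb : [tuple x i 1%N | i < s] = b.
  by apply: eq_from_tnth => i; rewrite tnth_mktuple /x flow1.
have fx : fss A x by split=> //; apply/lin_indep_free; rewrite // xb.
exists (\row_j mu j); split; first by move=> i j; rewrite !mxE; exact: mono.
exists x; split; last by move=> j; rewrite mxE; exact: bmu.
apply: fss_level_normal => // a; move: (levb a); congr (_ <= <<_>>)%VS.
rewrite (eq_enum (B := [pred i : 'I_s | (lyap_exp (x i) <= a%:E)%E])).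
  by apply: eq_map => i; rewrite /x flow1.
by move=> i; rewrite !inE -lee_fin -bmu.
Qed.

Lemma nondecr_spectrum : nondecr (lyap_spectrum A).
Proof. by have [] := lyap_spectrumP. Qed.

Lemma spectrum_value j :
  exists2 v, v != 0 & lyap_exp (flow A v) = (lyap_spectrum A 0 j)%:E.
Proof.
have [_ [x [[fx _] xE]]] := lyap_spectrumP.
exists (x j 1%N); first exact: (fss_neq0 _ fx).
by rewrite lyap_exp_flow //; case: fx.
Qed.

Lemma dim_level_spectrum a : (exists2 v, v != 0 & lyap_exp (flow A v) = a%:E) ->
  \dim (level A a) = #|[pred j : 'I_s | lyap_spectrum A 0 j <= a]|.
Proof.
have [_ [x [nx xE]]] := lyap_spectrumP; have [fx _] := nx.
move/(normal_fssP A_lyap fx).1 : nx => nx /nx ->.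
by apply: eq_card => j; rewrite !inE xE lee_fin.
Qed.

End spectrum.

Lemma card_ord_lt s m : (m <= s)%N -> #|[pred i : 'I_s | (i < m)%N]| = m.
Proof.
move=> ms; rewrite -sum1_card -[RHS](subnK (leq0n m)) subn0 addn0.
by rewrite -(big_ord_widen s (fun=> 1%N) ms) sum1_card card_ord.
Qed.

(** The indices with value at most [a] form an initial segment. *)
Lemma nondecr_le_card (R : realType) s (mu : 'rV[R]_s) (j : 'I_s) a :
  nondecr mu -> (mu 0 j <= a) = (j < #|[pred i : 'I_s | (mu 0 i <= a)%R]|)%N.
Proof.
move=> mono; apply/idP/idP => [ja|].
  rewrite -(card_ord_lt (ltn_ord j)); apply/subset_leq_card/fintype.subsetP => i.
  by rewrite !inE ltnS => /mono /le_trans; apply.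
apply: contraLR; rewrite -ltNge -leqNgt => aj.
rewrite -[leqRHS](card_ord_lt (ltnW (ltn_ord j))).
apply/subset_leq_card/fintype.subsetP => i.
rewrite !inE ltnNge; apply: contraTN => /mono ji.
by rewrite -ltNge (lt_le_trans aj).
Qed.

(** * Boosting the solutions of a system *)

(** Induction on the list: an injective sequence takes infinitely many values, of which only
    finitely many are occupied. *)
Lemma distinct_choice (I T : eqType) (g : I -> nat -> T) (l : seq I) :
  (forall i, injective (g i)) -> exists c : I -> nat,
    {in l &, injective (fun i => g i (c i))}.
Proof.
move=> ginj; elim: l => [|i l [c cinj]]; first by exists (fun=> 0).
have [il|il] := boolP (i \in l).
  exists c => j k; rewrite !inE => jl kl; apply: cinj.
    by case/orP: jl => // /eqP ->.
  by case/orP: kl => // /eqP ->.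
pose l' := [seq g j (c j) | j <- l].
have [m ml] : exists m, g i m \notin l'.
  apply: contrapT => nom.
  have : {subset [seq g i m | m <- iota 0 (size l').+1] <= l'}.
    move=> _ /mapP[m _ ->]; apply: contraT => h; case: nom; by exists m.
  move/uniq_leq_size; rewrite map_inj_uniq // iota_uniq => /(_ isT).
  by rewrite size_map size_iota ltnn.
exists (fun j => if j == i then m else c j) => j k; rewrite !inE.
have [-> _|ji /= jl] := eqVneq j i; have [-> _|ki /= kl] := eqVneq k i => //.
- by move=> h; case/negP: ml; rewrite h; apply: map_f.
- by move=> h; case/negP: ml; rewrite -h; apply/mapP; exists j.
- exact: cinj.
Qed.

(** * Exponents of stretched solutions *)

Section stretch.
Variables (R : realType) (s : nat) (J : nat -> bool).
Implicit Types (x : nat -> 'cV[R]_s) (d : R).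

(** A boost at time j acts on the step from j to j+1, so only the times 1, ..., n-1 count and
    nothing is boosted yet at time 1. *)
Definition boosts n := count J (iota 1 n.-1).

Definition stretch d x n := expR (d * (boosts n)%:R) *: x n.

Lemma boostsS n : (0 < n)%N -> boosts n.+1 = (boosts n + J n)%N.
Proof.
by case: n => // n _; rewrite /boosts -[n.+1 in LHS]addn1 iotaD count_cat /= addn0.
Qed.

Lemma boosts_le n : (boosts n <= n)%N.
Proof.
by rewrite (leq_trans (count_size _ _)) // size_iota leq_pred.
Qed.

Lemma stretch_neq0 d x n : x n != 0 -> stretch d x n != 0.
Proof. by move=> xn; rewrite scaler_eq0 negb_or xn gt_eqF // expR_gt0. Qed.

Lemma ln_enorm_stretch d x n : x n != 0 ->
  ln (enorm (stretch d x n)) = d * (boosts n)%:R + ln (enorm (x n)).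
Proof.
move=> xn; rewrite enormZ gtr0_norm ?expR_gt0 //.
by rewrite lnM ?posrE ?expR_gt0 ?enorm_gt0 // expRK.
Qed.

Variable x : nat -> 'cV[R]_s.
Hypothesis x_neq0 : forall n, (0 < n)%N -> x n != 0.

Lemma lyap_exp_stretch_le d a : 0 <= d -> (lyap_exp x <= a%:E)%E ->
  (lyap_exp (stretch d x) <= (a + d)%:E)%E.
Proof.
move=> d0 /(lyap_exp_le_lnP _ x_neq0) xa.
apply/lyap_exp_le_lnP => [n n0|e e0]; first exact/stretch_neq0/x_neq0.
have {}xa := xa e e0; near=> n.
have n0 : (0 < n)%N by near: n; exact: nbhs_infty_gt.
have : ln (enorm (x n)) <= (a + e) * n%:R by near: n; exact: xa.
rewrite ln_enorm_stretch ?x_neq0 //.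
have : d * (boosts n)%:R <= d * n%:R.
  by rewrite ler_wpM2l // ler_nat boosts_le.
by move=> ? ?; lra.
Unshelve. all: by end_near. Qed.

(** For each [n] the logarithm of the norm is affine in the boost size, and an upper limit of affine
    functions is convex. *)
Lemma lyap_exp_stretch_convex d t a b : 0 <= t <= 1 ->
  (lyap_exp x <= a%:E)%E -> (lyap_exp (stretch d x) <= b%:E)%E ->
  (lyap_exp (stretch (t * d) x) <= ((1 - t) * a + t * b)%:E)%E.
Proof.
move=> /andP[t0 t1] /(lyap_exp_le_lnP _ x_neq0) xa.
have sx0 d' n : (0 < n)%N -> stretch d' x n != 0.
  by move=> n0; exact/stretch_neq0/x_neq0.
move=> /(lyap_exp_le_lnP _ (sx0 d)) xb.
apply/(lyap_exp_le_lnP _ (sx0 _)) => e e0.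
have {}xa := xa e e0; have {}xb := xb e e0; near=> n.
have n0 : (0 < n)%N by near: n; exact: nbhs_infty_gt.
have : ln (enorm (x n)) <= (a + e) * n%:R by near: n; exact: xa.
have : ln (enorm (stretch d x n)) <= (b + e) * n%:R by near: n; exact: xb.
rewrite !ln_enorm_stretch ?x_neq0 //.
move=> /(ler_wpM2l t0) h1.
have t1' : 0 <= 1 - t by rewrite subr_ge0.
by move=> /(ler_wpM2l t1') h2; lra.
Unshelve. all: by end_near. Qed.

(* The exponent of the stretched solution is a convex function of [d]. *)
Lemma lyap_exp_stretch_increasing (r : R) (f : R -> R) :
  lyap_exp x = r%:E ->
  (forall d, 0 < d -> lyap_exp (stretch d x) = (f d)%:E /\ r < f d) ->
  forall a b, 0 < a < b -> f a < f b.
Proof.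
move=> xr hf a b /andP[a0 ab].
have b0 := lt_trans a0 ab.
have [fa _] := hf a a0; have [fb rb] := hf b b0.
have t1 : a / b < 1 by rewrite ltr_pdivrMr // mul1r.
have t0 : 0 < a / b by rewrite divr_gt0.
(* Interpolation at t = a / b between the boost sizes 0 and [b]: f a <= (1 - t) r + t f b < f b, as
   r < f b and t < 1. *)
have := @lyap_exp_stretch_convex b (a / b) r (f b).
rewrite divfK ?gt_eqF // xr fa fb !lee_fin !lexx (ltW t0) (ltW t1).
move=> /(_ isT isT isT) fab; apply: le_lt_trans fab _.
by move: (a / b) t0 t1 => t t0 t1; nra.
Qed.

Variables (sigma : nat) (r l : R) (k N : nat -> nat).
Hypotheses (sigma_gt0 : (0 < sigma)%N) (xr : lyap_exp x = r%:E).
Hypothesis k_real : realizing x (fun m => (k m * sigma)%N).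
Hypothesis N_boosts : forall n, (N n <= (boosts (n * sigma)).+1)%N.
Hypotheses (l_gt0 : 0 < l)
  (Nl : (fun m => (N (k m))%:R / (k m)%:R : R) @ \oo --> l).

(** At the realizing times k sigma the solution still grows at rate about [r], while about l k
    boosts or more have each added [d] to the logarithm. The rate thus gains roughly d l / sigma. *)
Lemma stretch_exp_gt d : 0 < d -> ~ (lyap_exp (stretch d x) <= r%:E)%E.
Proof.
move=> d0; have [kpos khomo kcvg] := k_real.
have kge m : (m <= k m)%N.
  elim: m => // m IH; rewrite (leq_ltn_trans IH) //.
  by have := khomo m m.+1 (ltnSn m); rewrite ltn_pmul2r.
have kgt0 m : (0 < k m)%N by have := kpos m; rewrite muln_gt0 => /andP[].
have sp : 0 < sigma%:R :> R by rewrite ltr0n.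
(* With this [e] the errors on both sides cost 2 e sigma k = d l k / 4, while the boosts gain at
   least d (l k / 2 - 1). The gain wins as soon as l k > 4, which [h3] ensures. *)
pose e := d * l / (8 * sigma%:R).
have e0 : 0 < e by rewrite divr_gt0 ?mulr_gt0.
move/lyap_exp_le_lnP => /(_ _)/(_ e e0) h.
have {}h : \forall n \near \oo, ln (enorm (stretch d x n)) <= (r + e) * n%:R.
  by apply: h => n n0; exact/stretch_neq0/x_neq0.
have [n0 _ hn0] := h.
have xcvg : (fun m => ln (enorm (x (k m * sigma)%N)) / (k m * sigma)%:R) @ \oo --> r.
  by move: kcvg; rewrite xr => /fine_cvg.
suff : \forall m \near \oo, False by move=> /filter_ex[].
near=> m.
have hm : ln (enorm (stretch d x (k m * sigma)%N)) <= (r + e) * (k m * sigma)%:R.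
  apply: hn0 => /=; rewrite (leq_trans _ (leq_pmulr _ sigma_gt0)) //.
  by rewrite (leq_trans _ (kge m)) //; near: m; exact: nbhs_infty_ge.
have h1 : r - e <= ln (enorm (x (k m * sigma)%N)) / (k m * sigma)%:R.
  by near: m; apply: (cvgr_ge _ xcvg); rewrite ltrBlDr ltrDl.
have h2 : l / 2 <= (N (k m))%:R / (k m)%:R.
  by near: m; apply: (cvgr_ge _ Nl); rewrite ltr_pdivrMr // ltr_pMr // ltr1n.
have h3 : 4 / l + 1 <= (k m)%:R.
  apply: (@le_trans _ _ m%:R); last by rewrite ler_nat.
  by near: m; exact: nbhs_infty_ger.
have kp : 0 < (k m)%:R :> R by rewrite ltr0n.
move: h1 h2 hm; rewrite ln_enorm_stretch ?x_neq0 ?muln_gt0 ?kgt0 //.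
rewrite !ler_pdivlMr ?ltr0n ?muln_gt0 ?kgt0 // natrM.
have := N_boosts (k m); rewrite -(ler_nat R) -natr1.
move: h3; rewrite -lerBrDr ler_pdivrMr //.
move: (ln _) (boosts _)%:R (N _)%:R => L M NN.
move: ((k m)%:R) kp => K kp h3 h4 h1 h2 h5.
have es : e * (K * sigma%:R) = d * (l * K / 8).
  by rewrite /e; field; rewrite gt_eqF.
have h6 : d * (l / 2 * K) <= d * (M + 1).
  by rewrite ler_wpM2l ?(ltW d0) //; lra.
have h7 : d * (l * K / 4) <= d by lra.
have : l * K / 4 <= 1 by rewrite -(ler_pM2l d0) mulr1.
by move=> ?; move: l_gt0 => ?; lra.
Unshelve. all: by end_near. Qed.

Lemma stretch_exp_fin d : 0 < d ->
  exists2 a, lyap_exp (stretch d x) = a%:E & r < a.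
Proof.
move=> d0; have := stretch_exp_gt d0.
have : (lyap_exp (stretch d x) <= (r + d)%:E)%E.
  by apply: lyap_exp_stretch_le; [exact: ltW|rewrite xr].
case: (lyap_exp _) => [a| |].
- by move=> _; rewrite lee_fin => /negP; rewrite -ltNge; exists a.
- by [].
- by move=> _ []; rewrite leNye.
Qed.

End stretch.

Definition wide_angle (R : realType) s (x : 'I_s -> nat -> 'cV[R]_s)
    sigma gamma i n :=
  (sigma %| n)%N && (gamma%:E <= phi x i n)%E.

(** Each counted j < n gives a boost at j sigma, before n sigma; only j = n may be missed, hence the
    successor. *)
Lemma Ncount_boosts (R : realType) s (x : 'I_s -> nat -> 'cV[R]_s)
    sigma gamma i n :
  (0 < sigma)%N ->
  (Ncount x i gamma n sigma <=
    (boosts (wide_angle x sigma gamma i) (n * sigma)).+1)%N.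
Proof.
move=> s0; rewrite /Ncount; case: n => // n.
rewrite -[n.+1 in X in (X <= _)%N]addn1 iotaD count_cat.
rewrite -[(boosts _ _).+1]addn1 leq_add //; last first.
  by rewrite (leq_trans (count_size _ _)).
rewrite /boosts -!size_filter.
rewrite -(size_map (fun j => (j * sigma)%N)); apply: uniq_leq_size.
  rewrite map_inj_uniq ?filter_uniq ?iota_uniq // => a b /eqP.
  by rewrite eqn_pmul2r // => /eqP.
move=> _ /mapP[j + ->]; rewrite !mem_filter !mem_iota => /andP[ga /andP[j0 jn]].
rewrite /wide_angle dvdn_mull // ga /= muln_gt0 j0 s0 /=.
rewrite add1n prednK ?muln_gt0 // ltn_pmul2r //; lia.
Qed.

(** * The boosted coefficient matrix *)

Section perturbation.
Variables (R : realType) (s : nat) (A : nat -> 'M[R]_s).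
Hypothesis A_lyap : lyapunov_sequence A.
Variable x : 'I_s -> nat -> 'cV[R]_s.
Hypothesis fx : fss A x.

(** The fundamental matrix of the system; in its coordinates a boost is diagonal. *)
Definition sol_mx n : 'M[R]_s := \matrix_(i, j) x j n i 0.

Lemma col_sol_mx n j : col j (sol_mx n) = x j n.
Proof. by apply/matrixP => i k; rewrite ord1 !mxE. Qed.

Lemma sol_mx_mul n (w : 'cV[R]_s) : sol_mx n *m w = \sum_j w j 0 *: x j n.
Proof.
apply/matrixP => i k; rewrite ord1 mxE summxE; apply: eq_bigr => j _.
by rewrite !mxE mulrC.
Qed.

(** A combination of solutions that vanishes at one time vanishes at all times, since the [A n] are
    invertible. *)
Lemma sol_mx_unit n : (0 < n)%N -> sol_mx n \in unitmx.
Proof.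
move=> n0; have [Ax xind] := fx.
rewrite -unitmx_tr -row_free_unit; apply: inj_row_free => v.
move/(congr1 trmx); rewrite trmx_mul trmxK trmx0 sol_mx_mul => vx.
have w0 : flow A (\sum_j v^T j 0 *: x j 1%N) n = 0.
  rewrite flow_sum -[RHS]vx; apply: eq_bigr => j _.
  by rewrite -solution_flow.
have c0 : forall j, v^T j 0 = 0.
  apply: xind => m m0.
  have -> : \sum_j v^T j 0 *: x j m = flow A (\sum_j v^T j 0 *: x j 1%N) m.
    by rewrite flow_sum; apply: eq_bigr => j _; rewrite -solution_flow.
  have -> : \sum_j v^T j 0 *: x j 1%N = 0; last by rewrite /flow mulmx0.
  by apply/eqP; apply: contraT => /(flow_neq0 A_lyap) /(_ n0); rewrite w0 eqxx.
by apply/rowP => j; rewrite [RHS]mxE -(c0 j) mxE.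
Qed.

Variables (sigma : nat) (gamma : 'I_s -> R).
Hypothesis gammaP : forall i, 0 < gamma i <= pi / 2.

Let J i := wide_angle x sigma (gamma i) i.

(** At a time of wide angle, 1 / sin (gamma i) bounds the norm of the projection onto the line of
    [x i] along the span of the others. *)
Definition sin_sum := \sum_i (sin (gamma i))^-1.

Lemma sin_gamma_gt0 i : 0 < sin (gamma i).
Proof.
have pi0 := pi_gt0 R.
by have /andP[g0 g1] := gammaP i; apply: sin_gt0_pi; apply/andP; split; lra.
Qed.

Lemma sin_sum_ge0 : 0 <= sin_sum.
Proof. by apply: sumr_ge0 => i _; rewrite invr_ge0 ltW // sin_gamma_gt0. Qed.

(** After division by [w j 0], the vector is [x j n] plus an element of the span of the others, so
    [component_le] applies. *)
Lemma sol_coord_le n (w : 'cV[R]_s) j : J j n ->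
  `|w j 0| * enorm (x j n) <= (sin (gamma j))^-1 * enorm (sol_mx n *m w).
Proof.
move=> /andP[_ gphi].
have [->|wj] := eqVneq (w j 0) 0.
  by rewrite normr0 mul0r mulr_ge0 ?enorm_ge0 // invr_ge0 ltW // sin_gamma_gt0.
rewrite ler_pdivlMl ?sin_gamma_gt0 //.
pose u := \sum_(i | i != j) (w i 0 / w j 0) *: x i n.
have -> : sol_mx n *m w = w j 0 *: (x j n + u).
  rewrite sol_mx_mul (bigD1 j) //= scalerDr scaler_sumr; congr (_ + _).
  by apply: eq_bigr => i _; rewrite scalerA mulrC divfK.
rewrite enormZ mulrCA ler_wpM2l //; apply: component_le gphi _ => //.
apply: memv_suml => i ij; rewrite memvZ // memv_span //.
by apply/mapP; exists i; rewrite // mem_filter ij mem_enum.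
Qed.

(** Only components along solutions boosted at time [n] survive, and [sol_coord_le] controls each of
    them. *)
Lemma diag_perturb_le n (e : 'rV[R]_s) (C : R) (v : 'cV[R]_s) :
  (0 < n)%N -> 0 <= C ->
  (forall j, if J j n then `|e 0 j| <= C else e 0 j == 0) ->
  enorm (sol_mx n *m diag_mx e *m invmx (sol_mx n) *m v) <=
    C * sin_sum * enorm v.
Proof.
move=> n0 C0 eC.
have [w -> {v}] : exists w, v = sol_mx n *m w.
  by exists (invmx (sol_mx n) *m v); rewrite mulKVmx // sol_mx_unit.
rewrite -mulmxA mulKmx ?sol_mx_unit // -mulmxA sol_mx_mul.
rewrite (le_trans (enorm_sum _ _)) // /sin_sum mulr_sumr mulr_suml.
apply: ler_sum => j _.
have -> : (diag_mx e *m w) j 0 = e 0 j * w j 0.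
  by rewrite mul_diag_mx mxE.
rewrite enormZ normrM -!mulrA; have := eC j.
case: ifPn => [Jj ej|_ /eqP ->]; last first.
  rewrite normr0 mul0r !mulr_ge0 ?enorm_ge0 // invr_ge0 ltW // sin_gamma_gt0.
  by [].
by rewrite ler_pM ?mulr_ge0 ?enorm_ge0 // sol_coord_le.
Qed.

Variable d : 'I_s -> R.
Hypothesis d_ge0 : forall i, 0 <= d i.

(** The factor [c] is 1 for the boost and -1 for its inverse. *)
Definition boost_row (c : R) n : 'rV[R]_s :=
  \row_j (if J j n then expR (c * d j) else 1).

Definition boosted n : 'M[R]_s :=
  A n *m (sol_mx n *m diag_mx (boost_row 1 n) *m invmx (sol_mx n)).

Lemma boost_rowV n :
  diag_mx (boost_row 1 n) *m diag_mx (boost_row (-1) n) = 1%:M.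
Proof.
rewrite mulmx_diag -diag_const_mx; congr diag_mx; apply/rowP => j; rewrite !mxE.
by case: ifP => _; rewrite ?mulr1 // -expRD mul1r mulN1r subrr expR0.
Qed.

Lemma boosted_unit n : (0 < n)%N -> boosted n \in unitmx.
Proof.
move=> n0; have [Au _ _] := A_lyap; have Xu := sol_mx_unit n0.
by rewrite !unitmx_mul Au // Xu unitmx_inv Xu (mulmx1_unit (boost_rowV n)).1.
Qed.

Lemma invmx_boosted n : (0 < n)%N -> invmx (boosted n) =
  sol_mx n *m diag_mx (boost_row (-1) n) *m invmx (sol_mx n) *m invmx (A n).
Proof.
move=> n0; have [Au _ _] := A_lyap; have Xu := sol_mx_unit n0.
apply: (can_inj (mulKmx (boosted_unit n0))); rewrite mulmxV ?boosted_unit //.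
rewrite /boosted !mulmxA; rewrite mulmxKV //.
rewrite -(mulmxA _ (diag_mx _) (diag_mx _)) boost_rowV mulmx1 mulmxK //.
by rewrite mulmxV // Au.
Qed.

(** Subtracting the identity leaves the conjugate of a diagonal matrix supported on the boosted
    indices. *)
Lemma boost_conj_le c n (v : 'cV[R]_s) (C : R) : (0 < n)%N -> 0 <= C ->
  (forall j, `|expR (c * d j) - 1| <= C) ->
  enorm (sol_mx n *m diag_mx (boost_row c n) *m invmx (sol_mx n) *m v - v) <=
    C * sin_sum * enorm v.
Proof.
move=> n0 C0 dC; have Xu := sol_mx_unit n0.
have -> : sol_mx n *m diag_mx (boost_row c n) *m invmx (sol_mx n) *m v - v =
    sol_mx n *m diag_mx (boost_row c n - const_mx 1) *m invmx (sol_mx n) *m v.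
  rewrite raddfB /= diag_const_mx mulmxBr mulmx1 !mulmxBl mulmxV //.
  by rewrite mul1mx.
apply: diag_perturb_le => // j; rewrite !mxE.
by case: (J j n); rewrite ?subrr.
Qed.

(** In the coordinates of [sol_mx n], [x i n] is the unit vector of index [i]; a step multiplies it
    by exp (d i) exactly when [boosts] increases. *)
Lemma boosted_solution i : solution boosted (stretch (J i) (d i) (x i)).
Proof.
move=> n n0; have Xu := sol_mx_unit n0; have [Ax _] := fx.
rewrite /stretch -scalemxAr /boosted.
have xi : x i n = sol_mx n *m delta_mx i 0 by rewrite -colE col_sol_mx.
rewrite xi -!mulmxA mulKmx // mul_diag_mx.
have -> : \matrix_(k, j) (boost_row 1 n 0 k * (delta_mx i 0 : 'cV_s) k j) =
    boost_row 1 n 0 i *: (delta_mx i 0 : 'cV_s).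
  apply/matrixP => k j; rewrite !mxE; case: eqP => [->|] //=.
  by rewrite !mulr0.
rewrite -!scalemxAr -xi -Ax // scalerA; congr (_ *: _).
rewrite boostsS // natrD mulrDr expRD; congr (_ * _); rewrite mxE mul1r.
by case: ifP => _; rewrite ?mulr1 // mulr0 expR0.
Qed.

(** No boost precedes time 1, so the stretched solutions start from the values of the [x i] and
    inherit their independence. *)
Lemma boosted_fss : fss boosted (fun i => stretch (J i) (d i) (x i)).
Proof.
split; first exact: boosted_solution.
have [_ xind] := fx; move=> c c0; apply: xind => n n0.
have [Ax _] := fx.
suff h : \sum_(i < s) c i *: x i 1%N = 0.
  have : flow A (\sum_(i < s) c i *: x i 1%N) n = 0 by rewrite h /flow mulmx0.
  rewrite flow_sum => hn; apply: etrans hn.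
  by apply: eq_bigr => i _; rewrite (solution_flow (Ax i) n0).
apply: etrans (c0 1%N isT); apply: eq_bigr => i _.
by rewrite /stretch /boosts /= mulr0 expR0 scale1r.
Qed.

End perturbation.

(** * Size and admissibility of the perturbation *)

Section admissible.
Variables (R : realType) (s : nat) (A : nat -> 'M[R]_s).
Hypothesis A_lyap : lyapunov_sequence A.
Variable x : 'I_s -> nat -> 'cV[R]_s.
Hypothesis fx : fss A x.
Variables (sigma : nat) (gamma : 'I_s -> R).
Hypothesis gammaP : forall i, 0 < gamma i <= pi / 2.

Lemma boosted_close (e : R) : 0 < e -> exists2 d0 : R, 0 < d0 &
  forall d : 'I_s -> R, (forall i, 0 <= d i <= d0) ->
    lyapunov_sequence (boosted A x sigma gamma d) /\
    (seqnorm (fun n => boosted A x sigma gamma d n - A n)%R < e%:E)%E.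
Proof.
move=> e0; have [Au Abd Aibd] := A_lyap.
have [C C0 AC] := seqnorm_bounded Abd.
have [C' C'0 AC'] := seqnorm_bounded Aibd.
have S0 := sin_sum_ge0 gammaP; set S := sin_sum gamma in S0.
have CS0 : 0 <= C * S by rewrite mulr_ge0.
(* If exp (d j) - 1 <= eta for all j, then [A] changes by at most C S eta <= e / 2. The half leaves
   room for a strict inequality after taking the supremum; the added 1 keeps the denominator
   positive. *)
pose eta := e / (2 * (C * S + 1)).
have eta0 : 0 < eta by rewrite divr_gt0 // mulr_gt0 // ltr_wpDl.
exists (ln (1 + eta)) => [|d dP]; first by rewrite ln_gt0 // ltrDl.
have dup j : `|expR (1 * d j) - 1| <= eta.
  have /andP[dj0 djeta] := dP j; rewrite mul1r.
  have : 1 <= expR (d j) by rewrite -expR0 ler_expR.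
  have : expR (d j) <= 1 + eta by rewrite -[leRHS]lnK ?posrE ?addr_gt0 // ler_expR.
  by move=> ? ?; rewrite ger0_norm; lra.
(* For the inverses only boundedness matters, so the crude bound 1 suffices. *)
have ddn j : `|expR (-1 * d j) - 1| <= 1.
  have /andP[dj0 _] := dP j; rewrite mulN1r.
  have : expR (- d j) <= 1 by rewrite -expR0 ler_expR oppr_le0.
  by have := expR_gt0 (- d j); move=> ? ?; rewrite ler0_norm; lra.
have QB n v : (0 < n)%N ->
    enorm ((boosted A x sigma gamma d n - A n) *m v) <= e / 2 * enorm v.
  move=> n0.
  have := boost_conj_le A_lyap fx sigma gammaP v n0 (ltW eta0) dup.
  rewrite -/S; set T := _ *m invmx _ => Tv.
  have -> : (boosted A x sigma gamma d n - A n) *m v = A n *m (T *m v - v).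
    by rewrite mulmxBl mulmxBr mulmxA.
  rewrite (le_trans (AC _ _ n0)) // (le_trans (ler_wpM2l C0 Tv)) // mulrA.
  rewrite ler_wpM2r ?enorm_ge0 //.
  have -> : C * (eta * S) = e / 2 * ((C * S) / (C * S + 1)).
    by rewrite /eta; field; rewrite gt_eqF // ltr_wpDl.
  rewrite ler_piMr ?divr_ge0 ?(ltW e0) // ler_pdivrMr ?ltr_wpDl //.
  by rewrite mul1r lerDl.
split; last first.
  apply: (@le_lt_trans _ _ (e / 2)%:E); last first.
    by rewrite lte_fin ltr_pdivrMr // ltr_pMr // ltr1n.
  by apply: seqnorm_le => //; rewrite divr_ge0 // ltW.
split.
- by move=> n; exact: boosted_unit.
- apply: le_lt_trans (ltry (e / 2 + C)); apply: seqnorm_le => [|n v n0].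
    by rewrite addr_ge0 // divr_ge0 // ltW.
  rewrite -[boosted _ _ _ _ _ _](subrK (A n)) mulmxDl mulrDl.
  by rewrite (le_trans (enormD _ _)) // lerD ?QB ?AC.
- apply: le_lt_trans (ltry ((S + 1) * C')); apply: seqnorm_le => [|n v n0].
    by rewrite !mulr_ge0 // addr_ge0.
  rewrite (invmx_boosted A_lyap fx) // -mulmxA.
  pose w := invmx (A n) *m v; rewrite -/w.
  have := boost_conj_le A_lyap fx sigma gammaP w n0 ler01 ddn.
  rewrite -/S mul1r; set T := _ *m invmx (sol_mx _ _) => Tw.
  rewrite -[T *m w](subrK w) (le_trans (enormD _ _)) //.
  rewrite (le_trans (lerD Tw (lexx _))) // -[X in _ + X]mul1r -mulrDl -mulrA.
  by rewrite ler_wpM2l ?addr_ge0 // AC'.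
Qed.

End admissible.

(** * Nearby systems with distinct exponents, and instability *)

Lemma splitted_perturbation (R : realType) s (A : nat -> 'M[R]_s)
    (x : 'I_s -> nat -> 'cV[R]_s) (e : R) :
  lyapunov_sequence A -> fss A x -> splitted x -> 0 < e ->
  exists (B : nat -> 'M[R]_s) (y : 'I_s -> nat -> 'cV[R]_s),
    [/\ lyapunov_sequence B, (seqnorm (fun n => B n - A n)%R < e%:E)%E, fss B y,
        injective (fun i => lyap_exp (y i))
      & forall i, (lyap_exp (x i) <= lyap_exp (y i))%E].
Proof.
move=> A_lyap fx [sigma sigma0 /choice[gamma brk]] e0.
have gammaP i : 0 < gamma i <= pi / 2 by have [k []] := brk i.
have [d0 d00 hd0] := boosted_close A_lyap fx sigma gammaP e0.
pose J i := wide_angle x sigma (gamma i) i.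
have [Ax _] := fx.
have x0 i n : (0 < n)%N -> x i n != 0.
  by apply: solution_neq0 (Ax i) _ => //; exact: fss_neq0 fx.
have /choice[r xr] : forall i, exists a, lyap_exp (x i) = a%:E.
  by move=> i; exact: fss_exp fx.
have /choice[f fP] : forall i, exists f : R -> R, forall d, 0 < d ->
    lyap_exp (stretch (J i) d (x i)) = (f d)%:E /\ r i < f d.
  move=> i; have [k [_ kreal [l l0 hl]]] := brk i.
  have hN n := Ncount_boosts x (gamma i) i n sigma0.
  have h d : 0 < d -> exists2 a, lyap_exp (stretch (J i) d (x i)) = a%:E & r i < a.
    exact: (stretch_exp_fin (x0 i) sigma0 (xr i) kreal hN l0 hl).
  exists (fun d => fine (lyap_exp (stretch (J i) d (x i)))) => d /h[a -> ra].
  by split.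
(* The boost sizes are taken among the numbers d0 / (m + 1). The resulting exponents strictly
   decrease in [m], so each [i] offers infinitely many values and [distinct_choice] can keep them
   apart. *)
pose g i m := f i (d0 / m.+1%:R).
have dm m : 0 < d0 / m.+1%:R by rewrite divr_gt0.
have glt i m m' : (m < m')%N -> g i m' < g i m.
  move=> mm'; apply: (lyap_exp_stretch_increasing (x0 i) (xr i) (fP i)).
  by rewrite dm ltr_pM2l // ltf_pV2 ?posrE // ltr_nat ltnS.
have ginj i : injective (g i).
  move=> m m' gm; apply/eqP; rewrite eqn_leq.
  by apply/andP; split; rewrite leqNgt; apply/negP => /(glt i); rewrite gm ltxx.
have [c cinj] := distinct_choice (enum 'I_s) ginj.
pose d i := d0 / (c i).+1%:R.
exists (boosted A x sigma gamma d), (fun i => stretch (J i) (d i) (x i)).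
have yE i : lyap_exp (stretch (J i) (d i) (x i)) = (g i (c i))%:E.
  exact: (fP i _ (dm _)).1.
have [|Bl Bc] := hd0 d.
  by move=> i; rewrite /d ltW //= ler_pdivrMr // ler_pMr // ler1n.
split; [exact: Bl | exact: Bc | exact: boosted_fss | |].
- move=> i j; rewrite !yE => -[h]; apply: cinj h; exact: mem_enum.
- by move=> i; rewrite yE xr lee_fin ltW // (fP i _ (dm _)).2.
Qed.

Theorem theorem6p1 (R : realType) (s : nat) (s_gt0 : (0 < s)%N)
    (A : nat -> 'M[R]_s) (A_lyap : lyapunov_sequence A)
    (A_split : exists x : 'I_s -> nat -> 'cV[R]_s,
       [/\ fss A x, splitted x & ~ normal_fss A x]) :
  ~ stable_spectrum A.
Proof.
have [x [fx xsplit]] := A_split.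
(* Failure of normality gives a value [a] at which too few of the [x i] have exponent at most [a];
   [p] is their number. *)
move/(normal_fssP A_lyap fx)/existsNP => [a /not_implyP[aval /eqP dimN]].
set p := #|_| in dimN.
have dimp : (p < \dim (level A a))%N.
  by rewrite ltn_neqAle eq_sym dimN card_fss_level.
have /choice[r xr] : forall i, exists b, lyap_exp (x i) = b%:E.
  by move=> i; exact: fss_exp fx.
have ps : (p < s)%N.
  rewrite (leq_trans dimp) // (leq_trans (dimvS (subvf _))) //.
  by rewrite dimvf dim_matrix mulr1.
(* Indices start at 0, so entry [p] is the one of rank p + 1; it is at most [a] because [level A a]
   has dimension greater than [p]. *)
pose j := Ordinal ps.
have muj : lyap_spectrum A 0 j <= a.
  by rewrite nondecr_le_card -?dim_level_spectrum //; exact: nondecr_spectrum.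
(* The gap between [a] and the exponents of [x] above it, capped at 1. *)
pose eta := \big[Num.min/1]_(i | a < r i) (r i - a).
have eta0 : 0 < eta.
  by apply/bigmin_gtP; split=> // i; rewrite subr_gt0.
have etaP i : r i < a + eta -> r i <= a.
  move=> rae; rewrite leNgt; apply/negP => ar.
  have : eta <= r i - a by apply: bigmin_le_cond.
  by rewrite lerBrDl leNgt rae.
move=> /(_ eta eta0)[e e0].
have [B [y [Bl Bc fy yinj xy]]] := splitted_perturbation A_lyap fx xsplit e0.
move=> /(_ (fun n => B n - A n)); rewrite /admissible.
have -> : (fun n => A n + (B n - A n)) = B by apply/funext => n; rewrite addrC subrK.
move=> /(_ Bl Bc)[_ /bigmax_ltP[_ /(_ j isT) numu]].
set nu := lyap_spectrum B in numu.
(* More than [p] of the [y i] would have exponent at most [nu 0 j], which is below a + eta. The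
   corresponding [x i] have no larger exponents, so by the gap these are at most [a], and there are
   only [p] such solutions. *)
have : (j < #|[pred i : 'I_s | (nu 0 i <= nu 0 j)%R]|)%N.
  by rewrite -nondecr_le_card //; exact: nondecr_spectrum.
rewrite -dim_level_spectrum //; last exact: spectrum_value.
have yn := distinct_exp_normal Bl fy yinj.
rewrite ((normal_fssP Bl fy).1 yn); last exact: spectrum_value.
rewrite ltnNge => /negP; apply; apply/subset_leq_card/fintype.subsetP => i.
rewrite !inE xr lee_fin => /(le_trans (xy i)); rewrite xr lee_fin => rnu.
apply: etaP; rewrite (le_lt_trans rnu) //.
by move: numu; rewrite ltr_norml => /andP[_]; lra.
Qed.
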